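(* Let $D$ be a finite digraph whose Sperner capacity is attained in finite length, i.e. there is a positive integer $k$ with $C_{\rm Sp}(D)=\sqrt[k]{\omega_{\rm tr}(D^k)}$. Then $C_{\rm Sp}(M(D))>C_{\rm Sp}(D)$.
   Context: Digraphs have no loops. For digraphs $F,G$, the OR-product $F\cdot G$ has vertex set $V(F)\times V(G)$ and a directed edge from $(f,g)$ to $(f',g')$ iff $(f,f')\in E(F)$ or $(g,g')\in E(G)$; $D^t$ is the $t$-fold OR-product of $D$ with itself. The transitive clique number $\omega_{\rm tr}(D)$ is the largest $m$ such that there are distinct vertices $q_1,\dots,q_m$ of $D$ with $(q_i,q_j)\in E(D)$ for all $i<j$. The Sperner capacity is $C_{\rm Sp}(D)=\lim_{t\to\infty}\sqrt[t]{\omega_{\rm tr}(D^t)}$. The Mycielskian $M(D)$ of a digraph $D$ has vertex set $V(D)\times\{0,1\}\cup\{z\}$ ($z$ a new vertex) and edge set $\{((v,0),(w,i)):(v,w)\in E(D),\ i\in\{0,1\}\}\cup\{((v,1),(w,0)):(v,w)\in E(D)\}\cup\{(z,(v,1)):v\in V(D)\}$. *)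

(* Defs.v *)
From mathcomp Require Import all_boot all_order all_algebra.
From mathcomp Require Import all_classical all_reals all_analysis.

Set Implicit Arguments.
Unset Strict Implicit.
Unset Printing Implicit Defensive.

Import Order.TTheory GRing.Theory Num.Theory.
Import numFieldNormedType.Exports.

Local Open Scope classical_set_scope.
Local Open Scope ring_scope.

Record digraph := Digraph {
  vertex :> finType;
  edge : rel vertex;
  edge_irr : irreflexive edge
}.

Definition or_edge (F G : digraph) : rel (F * G) :=
  fun x y => edge x.1 y.1 || edge x.2 y.2.

Lemma or_edge_irr (F G : digraph) : irreflexive (@or_edge F G).
Proof. by move=> x; rewrite /or_edge !edge_irr. Qed.

Definition or_prod (F G : digraph) : digraph := Digraph (@or_edge_irr F G).

Lemma point_edge_irr : irreflexive (fun _ _ : unit => false).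
Proof. by []. Qed.

Definition point_digraph : digraph := Digraph point_edge_irr.

(* D^1 is D itself and D^(t+1) is D . D^t for t >= 1. The one-vertex digraph, *)
(* which is neutral for the OR-product up to isomorphism, only serves as D^0. *)
Definition or_pow (D : digraph) (t : nat) : digraph :=
  iterop t or_prod D point_digraph.

(* The bound m <= #|D| loses nothing, the q_i being distinct. *)
Definition omega_tr (D : digraph) : nat :=
  (\max_(m < #|D|.+1 |
      [exists q : m.-tuple D, uniq q && pairwise (@edge D) q]) m)%N.

(* The t-th root is the power t^-1; the meaningless term t = 0 is 1. *)
Definition omega_tr_root (R : realType) (D : digraph) (t : nat) : R :=
  (omega_tr (or_pow D t))%:R `^ t%:R^-1.

Definition sperner_capacity (R : realType) (D : digraph) : R :=
  lim (omega_tr_root R D @ \oo).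

(* Some (v, false) is (v,0), Some (v, true) is (v,1), and None is z. *)
Definition mycielski_edge (D : digraph) : rel (option (D * bool)) :=
  fun x y => match x, y with
  | Some (v, false), Some (w, _) => edge v w
  | Some (v, true), Some (w, false) => edge v w
  | None, Some (_, true) => true
  | _, _ => false
  end.

Lemma mycielski_edge_irr (D : digraph) : irreflexive (@mycielski_edge D).
Proof. by case=> [[v []]|] //=; rewrite edge_irr. Qed.

Definition mycielskian (D : digraph) : digraph :=
  Digraph (@mycielski_edge_irr D).

(* Main.v *)
(* Let m be the transitive clique number of D^k, where the capacity of D is
   attained, and let N > 0 be at least m.  The N-fold product of a maximum
   clique of D^k consists of the m^N words of length N over m letters.  Mark in
   every word the block whose index is the sum of the letters modulo N, and move
   that block to the level-1 copy of D in M(D), all other blocks going to the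
   level-0 copy.  An edge of D survives unless it lies in a block marked in both
   words; ordering the words by sum, and then by the sum of their unmarked
   letters, any two words keep an edge.  As every word now has a level-1 block,
   (z,...,z) precedes all of them, so M(D)^(Nk) has a transitive clique of size
   m^N + 1.  By Fekete's lemma the capacity of M(D) is at least the (Nk)-th root
   of m^N + 1, which exceeds the k-th root of m. *)

Require Import Defs.
From mathcomp Require Import all_boot all_order all_algebra.
From mathcomp Require Import all_classical all_reals all_analysis.
From mathcomp Require Import zify lra.

Set Implicit Arguments.
Unset Strict Implicit.
Unset Printing Implicit Defensive.

Import Order.TTheory GRing.Theory Num.Theory.
Import numFieldNormedType.Exports.

Local Open Scope classical_set_scope.
Local Open Scope ring_scope.

Section Fekete.
Variable R : realType.

Definition superadditive (a : nat -> R) : Prop :=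
  forall s t, a s + a t <= a (s + t)%N.

Definition slopes (a : nat -> R) : set R :=
  [set a t / t%:R | t in [set t | (0 < t)%N]].

Lemma superadditive_mulrn (a : nat -> R) (s q : nat) :
  superadditive a -> (0 < q)%N -> a s *+ q <= a (q * s)%N.
Proof.
move=> aD; elim: q => [//|[_ _|q IHq _]]; first by rewrite mul1n.
by rewrite mulrS mulSn; apply: le_trans (aD _ _); rewrite lerD2l IHq.
Qed.

Lemma superadditive_divn (a : nat -> R) (s t : nat) :
  superadditive a -> (0 < t)%N ->
  a s *+ (t %/ s) + a 1%N *+ (t %% s) <= a t.
Proof.
move=> aD; rewrite {1 4}(divn_eq t s).
have mulrn_le r : (0 < r)%N -> a 1%N *+ r <= a r.
  by move/(superadditive_mulrn 1 aD); rewrite muln1.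
case: (t %/ s)%N (t %% s)%N => [|q] [|r] // _.
- by rewrite mulr0n add0r mul0n add0n mulrn_le.
- by rewrite mulr0n addr0 addn0 superadditive_mulrn.
- by apply: le_trans (aD _ _); rewrite lerD ?superadditive_mulrn ?mulrn_le.
Qed.

Lemma superadditive_slope_ge (a : nat -> R) (s t : nat) :
  superadditive a -> (0 < s)%N -> (0 < t)%N ->
  a s / s%:R - (a s - a 1%N *+ s) / t%:R <= a t / t%:R.
Proof.
move=> aD s_gt0 t_gt0; set slope := a s / s%:R.
have aE : a s = slope * s%:R by rewrite divfK // pnatr_eq0 -lt0n.
have slope_ge : a 1%N <= slope.
  by rewrite ler_pdivlMr ?ltr0n // mulr_natr -{2}[s]muln1 superadditive_mulrn.
have tE : t%:R = (t %/ s)%:R * s%:R + (t %% s)%:R :> R.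
  by rewrite -natrM -natrD -divn_eq.
have mod_le : (t %% s)%:R <= s%:R :> R by rewrite ler_nat ltnW // ltn_pmod.
have : 0 <= (slope - a 1%N) * (s%:R - (t %% s)%:R).
  by rewrite mulr_ge0 // subr_ge0.
rewrite lerBlDr -mulrDl ler_pdivlMr ?ltr0n // tE.
have := superadditive_divn s aD t_gt0.
by rewrite -(mulr_natr (a s)) -!(mulr_natr (a 1%N)) aE; lra.
Qed.

Lemma superadditive_cvg_sup (a : nat -> R) :
  superadditive a -> has_ubound (slopes a) ->
  a t / t%:R @[t --> \oo] --> sup (slopes a).
Proof.
move=> aD slopes_ub.
have slopes_sup : has_sup (slopes a) by split=> //; exists (a 1%N / 1%:R), 1%N.
apply/cvgrPdist_le => e e_gt0; have e2_gt0 : 0 < e / 2 by rewrite divr_gt0.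
have [_ [s /= s_gt0 <-] sup_lt] := sup_adherent e2_gt0 slopes_sup.
near=> t.
have t_gt0 : (0 < t)%N by near: t; exact: nbhs_infty_gt.
have le_sup : a t / t%:R <= sup (slopes a).
  by apply: ub_le_sup => //; exists t.
have excess_le : (a s - a 1%N *+ s) / t%:R <= e / 2.
  rewrite ler_pdivrMr ?ltr0n // mulrC -ler_pdivrMr //.
  by near: t; exact: nbhs_infty_ger.
have slope_ge := superadditive_slope_ge aD s_gt0 t_gt0.
rewrite ger0_norm ?subr_ge0 //; lra.
Unshelve. all: by end_near. Qed.

Lemma supermultiplicative_root_le_lim (u : nat -> R) (B : R) (t : nat) :
  (forall s t, u s * u t <= u (s + t)%N) -> (forall t, 0 < u t <= B ^+ t) ->
  (0 < t)%N -> u t `^ t%:R^-1 <= lim (u t `^ t%:R^-1 @[t --> \oo]).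
Proof.
move=> uM u_bounds t_gt0.
have u_gt0 s : 0 < u s by have /andP[] := u_bounds s.
have u_pos s : u s \is Num.pos by rewrite posrE.
have B_gt0 : 0 < B by have /andP[/lt_le_trans] := u_bounds 1%N; apply.
pose log_u s := ln (u s).
have rootE s : u s `^ s%:R^-1 = expR (log_u s / s%:R) by rewrite expRM lnK.
have log_superadditive : superadditive log_u.
  by move=> s r; rewrite -lnM // ler_ln // posrE mulr_gt0.
have log_ub : has_ubound (slopes log_u).
  exists (ln B) => _ [s /= s_gt0 <-].
  have /andP[_ u_le] := u_bounds s.
  by rewrite ler_pdivrMr ?ltr0n // mulr_natr -lnXn // ler_ln // posrE exprn_gt0.
have root_cvg : u s `^ s%:R^-1 @[s --> \oo] --> expR (sup (slopes log_u)).
  under eq_fun do rewrite rootE.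
  apply: continuous_cvg; first exact: continuous_expR.
  exact: superadditive_cvg_sup.
rewrite (cvg_lim _ root_cvg) // rootE ler_expR.
by apply: ub_le_sup => //; exists t.
Qed.

Lemma ltr_powR_inv_natM (x y : R) (n k : nat) :
  0 <= x -> (0 < n)%N -> (0 < k)%N -> x ^+ n < y ->
  x `^ k%:R^-1 < y `^ (n * k)%:R^-1.
Proof.
move=> x_ge0 n_gt0 k_gt0 lt_xy.
have -> : x `^ k%:R^-1 = (x ^+ n) `^ (n * k)%:R^-1.
  by rewrite -powR_mulrn // -powRrM natrM invfM mulVKf // pnatr_eq0 -lt0n.
have xn_ge0 : 0 <= x ^+ n by rewrite exprn_ge0.
rewrite gt0_ltr_powR ?invr_gt0 ?ltr0n ?muln_gt0 ?n_gt0 //.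
by rewrite nnegrE ltW // (le_lt_trans xn_ge0).
Qed.

End Fekete.

Lemma leq_sum_exists_ltn (I : finType) (P : pred I) (F G : I -> nat) :
  (\sum_(i | P i) F i <= \sum_(i | P i) G i)%N ->
  (exists2 i, P i & F i != G i) -> exists2 i, P i & (F i < G i)%N.
Proof.
move=> le_sum [j Pj neq_FG].
have [/exists_inP // | /exists_inPn no_lt] :=
  boolP [exists (i | P i), F i < G i]%N.
have [|sum_ge sum_eq] := @leqif_sum I P (fun i => G i == F i) G F.
  by move=> i Pi; split=> //; rewrite leqNgt no_lt.
move: sum_eq; rewrite eqn_leq sum_ge le_sum => /esym/forall_inP/(_ j Pj).
by rewrite eq_sym (negbTE neq_FG).
Qed.

Section TransitiveClique.
Implicit Types F G : digraph.

Lemma leq_card_omega_tr G (T : finType) (r : T -> nat) (f : T -> G) :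
  (forall x y, x != y -> (r x <= r y)%N -> edge (f x) (f y)) ->
  (#|T| <= omega_tr G)%N.
Proof.
move=> f_edge; pose s := sort (relpre r leq) (enum T).
have s_size : size (map f s) = #|T| by rewrite size_map size_sort -cardE.
have s_neq : pairwise [rel x y | x != y] s.
  by rewrite -uniq_pairwise sort_uniq enum_uniq.
have s_le : pairwise (relpre r leq) s.
  rewrite -sorted_pairwise; last by move=> y x z; exact: leq_trans.
  by apply: sort_sorted => x y; exact: leq_total.
have fs_edge : pairwise (@edge G) (map f s).
  have /andP := conj s_neq s_le; rewrite pairwise_map -pairwise_relI.
  by apply: sub_pairwise => x y /andP[]; exact: f_edge.
have fs_uniq : uniq (map f s).
  rewrite uniq_pairwise; apply: sub_pairwise fs_edge => x y /= xy.
  by apply: contraTneq xy => ->; rewrite edge_irr.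
have fs_lt : (size (map f s) < #|G|.+1)%N.
  by rewrite ltnS -(card_uniqP fs_uniq) max_card.
rewrite -s_size; apply: (bigop.bigmax_sup (Ordinal fs_lt)) => //=.
by apply/existsP; exists (in_tuple (map f s)); rewrite fs_uniq.
Qed.

Lemma omega_tr_clique G :
  exists q : 'I_(omega_tr G) -> G, {homo q : i j / (i < j)%N >-> edge i j}.
Proof.
pose has_clique (m : 'I_#|G|.+1) :=
  [exists q : m.-tuple G, uniq q && pairwise (@edge G) q].
have : (0 < #|has_clique|)%N.
  by apply/card_gt0P; exists ord0; apply/existsP; exists [tuple].
case/(eq_bigmax_cond (fun m => val m)) => m /existsP[q /andP[_ q_edge]].
rewrite -/(omega_tr G) => ->; exists (tnth q) => i j lt_ij.
have v : G := tnth q i.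
rewrite !(tnth_nth v).
by apply: (pairwiseP _ q_edge) => //; rewrite inE size_tuple.
Qed.

Lemma omega_tr_leq_card G : (omega_tr G <= #|G|)%N.
Proof. by apply/bigmax_leqP => m _; rewrite -ltnS. Qed.

Lemma omega_tr_gt0 G (v : G) : (0 < omega_tr G)%N.
Proof.
rewrite -card_unit.
by apply: (@leq_card_omega_tr _ _ (fun=> 0%N) (fun=> v)) => -[] [].
Qed.

Definition homomorphic F G : Prop :=
  exists f : F -> G, {homo f : x y / edge x y}.

Lemma homomorphic_omega_tr F G :
  homomorphic F G -> (omega_tr F <= omega_tr G)%N.
Proof.
move=> [f f_edge]; have [q q_edge] := omega_tr_clique F.
rewrite -{1}[omega_tr F]card_ord.
apply: (@leq_card_omega_tr _ _ val (f \o q)) => i j neq_ij le_ij.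
by apply/f_edge/q_edge; rewrite ltn_neqAle neq_ij.
Qed.

Lemma omega_tr_or_prod F G :
  (omega_tr F * omega_tr G <= omega_tr (or_prod F G))%N.
Proof.
have [p p_edge] := omega_tr_clique F; have [q q_edge] := omega_tr_clique G.
rewrite -[omega_tr F]card_ord -{1}[omega_tr G]card_ord -card_prod.
apply: (@leq_card_omega_tr (or_prod F G)
  ('I_(omega_tr F) * 'I_(omega_tr G))%type
  (fun ij => ij.1 * omega_tr G + ij.2)%N (fun ij => (p ij.1, q ij.2))).
move=> [i j] [i' j'] neq_ij /= le_rank; apply/orP => /=.
have [lt_i|lt_i|eq_i] := ltngtP i i'; first by left; apply: p_edge.
  by have := ltn_ord j'; nia.
right; apply: q_edge; rewrite ltn_neqAle; apply/andP; split; last by lia.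
by apply: contraNneq neq_ij => eq_j; apply/eqP; congr pair; exact: val_inj.
Qed.

End TransitiveClique.

Section FunctionPower.
Implicit Types (D : digraph) (I J : finType).

Definition fun_edge D I : rel {ffun I -> D} :=
  fun x y => [exists i, edge (x i) (y i)].

Lemma fun_edge_irr D I : irreflexive (@fun_edge D I).
Proof. by move=> x; apply/existsP => -[i]; rewrite edge_irr. Qed.

Definition fun_pow D I : digraph := Digraph (@fun_edge_irr D I).

Lemma or_pow_fun_pow D (n : nat) : homomorphic (or_pow D n) (fun_pow D 'I_n).
Proof.
elim: n => [|[|n] [f f_edge]]; first by exists (fun=> ffun0 (card_ord 0)).
  exists (fun x : D => [ffun=> x]) => x y xy /=.
  by apply/existsP; exists ord0; rewrite !ffunE.
exists (fun x : D * or_pow D n.+1 =>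
  [ffun i => if unlift ord0 i is Some j then f x.2 j else x.1]).
move=> [x1 x2] [y1 y2] /orP[/= xy|/= /f_edge /existsP[j xy]].
  by apply/existsP; exists ord0; rewrite !ffunE unlift_none.
by apply/existsP; exists (lift ord0 j); rewrite !ffunE liftK.
Qed.

Lemma fun_pow_or_pow D (n : nat) : homomorphic (fun_pow D 'I_n) (or_pow D n).
Proof.
elim: n => [|[|n] [f f_edge]].
- by exists (fun=> tt) => x y /existsP[[]].
- exists (fun x : {ffun 'I_1 -> D} => x ord0) => x y /existsP[i].
  by rewrite (ord1 i).
exists (fun x : {ffun 'I_n.+2 -> D} =>
  (x ord0, f [ffun j => x (lift ord0 j)]) : or_pow D n.+2).
move=> x y /existsP[i]; case: (unliftP ord0 i) => [j ->|->] xy; last first.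
  by apply/orP; left.
by apply/orP; right; apply: f_edge; apply/existsP; exists j; rewrite !ffunE.
Qed.

Lemma fun_pow_reindex D I J (f : J -> I) (g : I -> J) :
  cancel g f -> homomorphic (fun_pow D I) (fun_pow D J).
Proof.
move=> gK; exists (fun x : {ffun I -> D} => [ffun j => x (f j)]).
by move=> x y /existsP[i xy]; apply/existsP; exists (g i); rewrite !ffunE gK.
Qed.

Lemma fun_pow_sum D I J :
  homomorphic (or_prod (fun_pow D I) (fun_pow D J)) (fun_pow D (I + J)%type).
Proof.
exists (fun x : {ffun I -> D} * {ffun J -> D} =>
  [ffun k => match k with inl i => x.1 i | inr j => x.2 j end]).
move=> x y /orP[] /existsP[i xy]; apply/existsP.
  by exists (inl i); rewrite !ffunE.
by exists (inr i); rewrite !ffunE.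
Qed.

Lemma omega_tr_fun_pow D I : omega_tr (fun_pow D I) = omega_tr (or_pow D #|I|).
Proof.
apply/eqP; rewrite eqn_leq; apply/andP; split.
  apply: leq_trans (homomorphic_omega_tr (fun_pow_or_pow D #|I|)).
  exact/homomorphic_omega_tr/fun_pow_reindex/enum_rankK.
apply: (leq_trans (homomorphic_omega_tr (or_pow_fun_pow D #|I|))).
exact/homomorphic_omega_tr/fun_pow_reindex/enum_valK.
Qed.

Lemma omega_tr_or_pow D (n : nat) :
  omega_tr (or_pow D n) = omega_tr (fun_pow D 'I_n).
Proof. by rewrite omega_tr_fun_pow card_ord. Qed.

Lemma omega_tr_or_pow_gt0 D (v : D) (n : nat) : (0 < omega_tr (or_pow D n))%N.
Proof. by rewrite omega_tr_or_pow (@omega_tr_gt0 (fun_pow D _) [ffun=> v]). Qed.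

Lemma omega_tr_or_pow_leq D (n : nat) : (omega_tr (or_pow D n) <= #|D| ^ n)%N.
Proof.
rewrite omega_tr_or_pow -[n in leqRHS]card_ord -card_ffun.
exact: omega_tr_leq_card.
Qed.

Lemma omega_tr_or_powD D (a b : nat) :
  (omega_tr (or_pow D a) * omega_tr (or_pow D b) <=
   omega_tr (or_pow D (a + b)))%N.
Proof.
rewrite -{2}[a]card_ord -{2}[b]card_ord -card_sum -omega_tr_fun_pow.
rewrite !omega_tr_or_pow; apply: leq_trans (omega_tr_or_prod _ _) _.
exact/homomorphic_omega_tr/fun_pow_sum.
Qed.

End FunctionPower.

Lemma omega_tr_root_le_capacity (R : realType) (D : digraph) (v : D) (t : nat) :
  (0 < t)%N -> omega_tr_root R D t <= sperner_capacity R D.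
Proof.
apply: (@supermultiplicative_root_le_lim _ _ #|D|%:R) => [s r|s].
  by rewrite -natrM ler_nat omega_tr_or_powD.
by rewrite ltr0n omega_tr_or_pow_gt0 // -natrX ler_nat omega_tr_or_pow_leq.
Qed.

Section Words.
Variables m n : nat.
Hypothesis letters_le_length : (m <= n.+1)%N.
Implicit Types x y : {ffun 'I_n.+1 -> 'I_m}.

Definition word_sum x : nat := (\sum_b x b)%N.

Definition word_mark x : 'I_n.+1 := inord (word_sum x %% n.+1).

Definition unmarked_sum x : nat := (\sum_(b | b != word_mark x) x b)%N.

(* Since word_sum x - unmarked_sum x is at most n, comparing ranks amounts to
   comparing the pairs (word_sum x, unmarked_sum x) lexicographically. *)
Definition word_rank x : nat := (n.+1 * word_sum x + unmarked_sum x)%N.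

Lemma word_sum_unmarked x : word_sum x = (x (word_mark x) + unmarked_sum x)%N.
Proof. by rewrite /word_sum (bigD1 (word_mark x)). Qed.

Lemma word_letter_leq x b : (x b <= n)%N.
Proof. by rewrite -ltnS (leq_trans (ltn_ord _)). Qed.

Lemma word_rank_leq_sum x y :
  (word_rank x <= word_rank y)%N -> (word_sum x <= word_sum y)%N.
Proof.
rewrite /word_rank => le_rank.
have := word_sum_unmarked x; have := word_letter_leq x (word_mark x).
have := word_sum_unmarked y; nia.
Qed.

Lemma word_mark_eq_mod x y :
  word_mark x = word_mark y -> (word_sum x = word_sum y %[mod n.+1])%N.
Proof. by move/(congr1 val); rewrite /= !inordK ?ltn_pmod. Qed.

(* Sums in the same residue class differ by a multiple of n+1, which the marked
   letter alone cannot account for. *)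
Lemma word_rank_leq_unmarked_sum x y :
  word_mark x = word_mark y -> (word_rank x <= word_rank y)%N ->
  (unmarked_sum x <= unmarked_sum y)%N.
Proof.
move=> eq_mark le_rank; have := word_rank_leq_sum le_rank.
rewrite leq_eqVlt => /predU1P[eq_sum|lt_sum].
  by move: le_rank; rewrite /word_rank eq_sum leq_add2l.
have : (n.+1 %| word_sum y - word_sum x)%N.
  by rewrite -eqn_mod_dvd ?(word_mark_eq_mod eq_mark) // ltnW.
move=> /dvdn_leq; rewrite subn_gt0 => /(_ lt_sum).
have := word_letter_leq y (word_mark y).
have := word_sum_unmarked x; have := word_sum_unmarked y; lia.
Qed.

Lemma eq_unmarked_letters x y :
  word_mark x = word_mark y -> (forall b, b != word_mark x -> x b = y b) ->
  x = y.
Proof.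
move=> eq_mark eq_xy.
have eq_unmarked : unmarked_sum x = unmarked_sum y.
  by rewrite /unmarked_sum -eq_mark; apply: eq_bigr => b /eq_xy->.
apply/ffunP => b; have [->|/eq_xy//] := eqVneq b (word_mark x).
apply/val_inj/eqP; have := word_mark_eq_mod eq_mark.
rewrite !word_sum_unmarked -eq_mark eq_unmarked => /eqP.
by rewrite eqn_modDr !modn_small ?ltnS ?word_letter_leq.
Qed.

Lemma word_rank_increase x y :
  x != y -> (word_rank x <= word_rank y)%N ->
  exists2 b, (x b < y b)%N & ~~ ((b == word_mark x) && (b == word_mark y)).
Proof.
move=> neq_xy le_rank.
have [eq_mark|neq_mark] := eqVneq (word_mark x) (word_mark y).
  have [||b] := @leq_sum_exists_ltn _ (predC1 (word_mark x))
    (fun b => x b) (fun b => y b).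
  - have := word_rank_leq_unmarked_sum eq_mark le_rank.
    by rewrite /unmarked_sum -eq_mark.
  - apply/exists_inP; apply: contraNT neq_xy => /exists_inPn eq_xy.
    apply/eqP/eq_unmarked_letters => // b /eq_xy.
    by rewrite negbK => /eqP/val_inj.
  - by rewrite /= => unmarked lt_xy; exists b; rewrite // (negbTE unmarked).
have [||b _ lt_xy] := @leq_sum_exists_ltn _ predT (fun b => x b) (fun b => y b).
- exact: word_rank_leq_sum.
- apply/exists_inP; apply: contraNT neq_xy => /exists_inPn eq_xy.
  by apply/eqP/ffunP => b; apply/val_inj/eqP; rewrite -[_ == _]negbK eq_xy.
by exists b => //; apply: contra neq_mark => /andP[/eqP<- /eqP<-].
Qed.

End Words.

Lemma mycielskian_edge (D : digraph) (v w : D) (a b : bool) :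
  edge v w -> ~~ (a && b) ->
  @edge (mycielskian D) (Some (v, a)) (Some (w, b)).
Proof. by case: a b => [] []. Qed.

Section MycielskianClique.
Variables (D : digraph) (J : finType) (m n : nat) (q : 'I_m -> fun_pow D J).
Hypothesis letters_le_length : (m <= n.+1)%N.
Hypothesis q_edge : {homo q : a b / (a < b)%N >-> edge a b}.
Implicit Types x y : {ffun 'I_n.+1 -> 'I_m}.

Definition word_vertex x : fun_pow (mycielskian D) ('I_n.+1 * J)%type :=
  [ffun p => Some ((q (x p.1) : {ffun J -> D}) p.2, p.1 == word_mark x)].

Lemma word_vertex_edge x y :
  x != y -> (word_rank x <= word_rank y)%N ->
  edge (word_vertex x) (word_vertex y).
Proof.
move=> neq_xy /(word_rank_increase letters_le_length neq_xy)[b].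
move=> /q_edge/existsP[j xy] not_both_marked.
by apply/existsP; exists (b, j); rewrite !ffunE; exact: mycielskian_edge.
Qed.

Lemma apex_edge x (j : J) :
  @edge (fun_pow (mycielskian D) _) [ffun=> None] (word_vertex x).
Proof. by apply/existsP; exists (word_mark x, j); rewrite !ffunE /= eqxx. Qed.

Lemma expn_ltn_omega_tr_mycielskian (j : J) :
  (m ^ n.+1 < omega_tr (fun_pow (mycielskian D) ('I_n.+1 * J)%type))%N.
Proof.
rewrite -{1}[m]card_ord -{1}[n.+1]card_ord -card_ffun -card_option.
apply: (@leq_card_omega_tr _ _ (oapp (succn \o @word_rank m n) 0%N)
  (oapp word_vertex [ffun=> None])) => -[x|] [y|] //=.
  by rewrite ltnS => neq_xy; exact: word_vertex_edge.
by move=> _ _; exact: apex_edge.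
Qed.

End MycielskianClique.

Lemma omega_tr_mycielskian_pow (D : digraph) (k n : nat) :
  (0 < k)%N -> (omega_tr (or_pow D k) <= n.+1)%N ->
  (omega_tr (or_pow D k) ^ n.+1 <
   omega_tr (or_pow (mycielskian D) (n.+1 * k)))%N.
Proof.
rewrite omega_tr_or_pow => k_gt0 omega_le.
have [q q_edge] := omega_tr_clique (fun_pow D 'I_k).
rewrite -[(n.+1 * k)%N](_ : #|{: 'I_n.+1 * 'I_k}| = _); last first.
  by rewrite card_prod !card_ord.
rewrite -omega_tr_fun_pow.
exact: expn_ltn_omega_tr_mycielskian omega_le q_edge (Ordinal k_gt0).
Qed.

Theorem theorem7 (R : realType) (D : digraph)
    (attained : exists k : nat,
       (0 < k)%N /\
       sperner_capacity R D = (omega_tr (or_pow D k))%:R `^ k%:R^-1) :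
  sperner_capacity R D < sperner_capacity R (mycielskian D).
Proof.
have [k [k_gt0 ->]] := attained.
set m := omega_tr (or_pow D k).
have length_gt0 : (0 < m.+1 * k)%N by rewrite muln_gt0.
apply: lt_le_trans
  (@omega_tr_root_le_capacity R (mycielskian D) None _ length_gt0).
apply: ltr_powR_inv_natM => //.
by rewrite -natrX ltr_nat; apply: omega_tr_mycielskian_pow.
Qed.
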